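(* Let $P=(p_{ij})$ be a real $N\times N$ mixed Monge matrix that is symmetric about the anti-main diagonal, and let $\pi\in S_N$ be a permutation that maximizes the objective function $F(\pi)=M_\pi\cdot P=\sum_{i=1}^N p_{i\pi(i)}$ over $S_N$. Then the permutation matrix $M_\pi$ is also symmetric about the anti-main diagonal.
   Context: $M_\pi$ is the $N\times N$ matrix with $(i,j)$ entry $1$ if $\pi(i)=j$ and $0$ otherwise; $A\cdot B=\sum_{i,j}A_{ij}B_{ij}$. An $N\times N$ matrix $A$ is symmetric about the anti-main diagonal if $A_{ij}=A_{N+1-j,\,N+1-i}$ for all $i,j$. A real matrix $P=(p_{ij})_{1\le i,j\le N}$ is mixed Monge if for all $i<i'$ and $j<j'$: (a) if $i\le j$ and $i'\le j'$, not both equalities (at least three of the four vertices $(i,j),(i,j'),(i',j),(i',j')$ lie on or above the main diagonal, and not two of them on it), then $p_{ij'}+p_{i'j}>p_{ij}+p_{i'j'}$; (b) if $i\ge j$ and $i'\ge j'$, not both equalities (at least three vertices lie on or below the main diagonal, and not two of them on it), then $p_{ij}+p_{i'j'}>p_{ij'}+p_{i'j}$; (c) if $i=j$ and $i'=j'$, then $p_{ij}+p_{i'j'}=p_{ij'}+p_{i'j}$. *)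

(* Defs.v *)
From mathcomp Require Import all_boot all_order all_fingroup all_algebra.
From mathcomp Require Import reals.

Set Implicit Arguments.
Unset Strict Implicit.
Unset Printing Implicit Defensive.

Import Order.TTheory GRing.Theory Num.Theory.

Local Open Scope ring_scope.

(* The 1-based index 1 <= i <= N is the ordinal i - 1 : 'I_N, so that N + 1 - i
   is [rev_ord i].  M_pi is the library's [perm_mx pi], whose (i, j) entry is
   (pi i == j)%:R. *)

Definition mxdot (R : realType) (N : nat) (A B : 'M[R]_N) : R :=
  \sum_(i < N) \sum_(j < N) A i j * B i j.

Definition antidiag_symmetric (R : realType) (N : nat) (A : 'M[R]_N) : Prop :=
  forall i j : 'I_N, A i j = A (rev_ord j) (rev_ord i).

Definition mixed_monge (R : realType) (N : nat) (P : 'M[R]_N) : Prop :=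
  forall i i' j j' : 'I_N, (i < i')%N -> (j < j')%N ->
  [/\ (i <= j)%N -> (i' <= j')%N -> ~ (i = j /\ i' = j') ->
        P i j' + P i' j > P i j + P i' j',
      (j <= i)%N -> (j' <= i')%N -> ~ (i = j /\ i' = j') ->
        P i j + P i' j' > P i j' + P i' j
    & i = j -> i' = j' ->
        P i j + P i' j' = P i j' + P i' j].

Definition perm_objective (R : realType) (N : nat) (P : 'M[R]_N) (pi : 'S_N)
  : R := mxdot (perm_mx pi) P.

Definition maximizes_objective (R : realType) (N : nat) (P : 'M[R]_N)
    (pi : 'S_N) : Prop :=
  forall sigma : 'S_N, perm_objective P sigma <= perm_objective P pi.

Lemma perm_objectiveE (R : realType) (N : nat) (P : 'M[R]_N) (pi : 'S_N) :
  perm_objective P pi = \sum_(i < N) P i (pi i).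
Proof.
rewrite /perm_objective /mxdot; apply: eq_bigr => i _.
rewrite (bigD1 (pi i)) //= !mxE eqxx mul1r big1 ?addr0 // => j ne_j.
by rewrite !mxE eq_sym (negbTE ne_j) mul0r.
Qed.

(* Main.v *)
Require Import Defs.
From mathcomp Require Import all_boot all_order all_fingroup all_algebra.
From mathcomp Require Import reals.
From mathcomp Require Import zify lra.

(** With [psi i := rev_ord (pi i)] and [Q i k := P i (rev_ord k)], the matrix [Q]
    is symmetric and [psi] maximizes [\sum_i Q i (psi i)].  Two copies of a cycle
    of [psi], with both copies of an edge [i, psi i] replaced by loops at its
    ends, decompose into two involutions, so
    [Q i i + Q (psi i) (psi i) <= 2 Q i (psi i)].  With condition (a) this puts
    every strict excedance of [pi] on the anti-diagonal.  Hence [pi] and its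
    reflection have the same strict excedances and agree on them.  By
    condition (b) both are increasing on the remaining rows, so they coincide. *)

Set Implicit Arguments.
Unset Strict Implicit.
Unset Printing Implicit Defensive.

Import Order.TTheory GRing.Theory Num.Theory.

Local Open Scope ring_scope.

(** Turns an involution of positions in a list stable under [s] into a competitor of [s]; stability
    makes the two pieces fit together bijectively. *)
Lemma perm_reorder_seq (T : finType) (s : {perm T}) (o : seq T)
    (f : nat -> nat) :
  uniq o -> (forall x, (s x \in o) = (x \in o)) ->
  (forall t, (t < size o)%N -> (f t < size o)%N) ->
  (forall t, (t < size o)%N -> f (f t) = t) ->
  exists p : {perm T}, (forall x, x \notin o -> p x = s x) /\
    (forall x0 t, (t < size o)%N -> p (nth x0 o t) = nth x0 o (f t)).
Proof.
move=> uo so flt fK.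
pose g x := if x \in o then nth x o (f (index x o)) else s x.
have go x : (g x \in o) = (x \in o).
  rewrite /g; case: ifP => [xo|xo]; last by rewrite so.
  by rewrite mem_nth // flt // index_mem.
have g_inj : injective g.
  move=> x y eg; have := go y; rewrite -eg go => exy.
  move: eg; rewrite /g exy; case: ifP => yo; last exact: perm_inj.
  have [ix iy] : (index x o < size o)%N /\ (index y o < size o)%N.
    by rewrite !index_mem exy.
  rewrite (set_nth_default x y) ?flt // => /eqP.
  rewrite nth_uniq ?flt // => /eqP /(congr1 f); rewrite !fK // => exy'.
  by rewrite -(nth_index x yo) -exy' nth_index // exy.
exists (perm g_inj); split=> [x xo | x0 t lt_t].
  by rewrite permE /g (negbTE xo).
rewrite permE /g mem_nth // index_uniq //.
exact/set_nth_default/flt.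
Qed.

(* The two values of [c] pair up the vertices of the path 0 - 1 - ... - L.-1
   along its alternate edges, unpaired end vertices being fixed. *)
Definition path_matching (c : bool) (L t : nat) : nat :=
  if odd t == c then t.-1 else minn t.+1 L.-1.

Lemma path_matching_lt c L t : (t < L)%N -> (path_matching c L t < L)%N.
Proof. by rewrite /path_matching; case: eqP => _; lia. Qed.

Lemma path_matchingK c L t :
  (t < L)%N -> path_matching c L (path_matching c L t) = t.
Proof. by rewrite /path_matching; case: c; do 2 case: eqP; lia. Qed.

(** Together the matchings send each [t] once to [t.-1] and once to [minn t.+1 L]. Truncation yields
    the two end loops, and each edge is met from both sides. *)
Lemma sum_path_matching (R : realDomainType) (q : nat -> nat -> R) (L : nat) :
  (forall t u, q t u = q u t) ->
  \sum_(t < L.+1) q t (path_matching true L.+1 t) +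
  \sum_(t < L.+1) q t (path_matching false L.+1 t) =
  q 0%N 0%N + q L L + (\sum_(t < L) q t t.+1) *+ 2.
Proof.
move=> qC; rewrite -big_split /=.
rewrite (eq_bigr (fun t : 'I_L.+1 => q t t.-1 + q t (minn t.+1 L))); last first.
  by move=> t _; rewrite /path_matching /=; case: (odd t) => //=; rewrite addrC.
rewrite big_split /= big_ord_recl big_ord_recr /=.
rewrite (minn_idPr (leqnSn L)).
under eq_bigr => t _ do rewrite /bump /= add1n qC.
under [X in _ + (X + _)]eq_bigr => t _ do rewrite (minn_idPl (ltn_ord t)).
by rewrite mulr2n; lra.
Qed.

Lemma symmetric_max_loops (R : realDomainType) (T : finType) (Q : T -> T -> R)
    (s : {perm T}) :
  (forall x y, Q x y = Q y x) ->
  (forall p : {perm T}, \sum_x Q x (p x) <= \sum_x Q x (s x)) ->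
  forall x, Q x x + Q (s x) (s x) <= Q x (s x) *+ 2.
Proof.
move=> QC smax x.
(* Starting the orbit at [s x] makes it a path ending in [x], with every edge of the cycle except
   the one from [x] to [s x]. The path edges cancel at the end, leaving that edge against the two
   loops. *)
pose o := fingraph.orbit s (s x); pose y t := nth (s x) o t.
have uo : uniq o by exact: orbit_uniq.
have so z : (s z \in o) = (z \in o).
  by rewrite -!fconnect_orbit -(same_fconnect1_r (@perm_inj _ s)).
have [L oL] : exists L, size o = L.+1.
  by exists (size o).-1; rewrite size_orbit orderSpred.
have yE t : (t < L.+1)%N -> y t = iter t s (s x).
  move=> lt_t; rewrite /y /o /fingraph.orbit nth_traject //.
  by rewrite -(size_orbit s) -/o oL.
have yL : y L = x.
  apply: (@perm_inj _ s); rewrite yE // -iterS -oL size_orbit.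
  exact/iter_order/perm_inj.
have sumE (p : {perm T}) : \sum_z Q z (p z) =
    \sum_(t < L.+1) Q (y t) (p (y t)) + \sum_(z | z \notin o) Q z (p z).
  by rewrite (bigID (mem o)) /= -big_uniq // (big_nth (s x)) oL big_mkord.
have matching c : \sum_(t < L.+1) Q (y t) (y (path_matching c L.+1 t))
    <= \sum_(t < L.+1) Q (y t) (s (y t)).
  have [| |p [pout pin]] := @perm_reorder_seq _ s o (path_matching c L.+1) uo so.
  - by rewrite oL => t; exact: path_matching_lt.
  - by rewrite oL => t; exact: path_matchingK.
  have := smax p; rewrite !sumE.
  rewrite [X in _ + X <= _](eq_bigr (fun z => Q z (s z))); last first.
    by move=> z /pout ->.
  rewrite lerD2r; congr (_ <= _); apply: eq_bigr => t _.
  by rewrite /y pin ?oL.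
have := lerD (matching true) (matching false).
rewrite (sum_path_matching (q := fun t u => Q (y t) (y u))); last by move=> *.
rewrite big_ord_recr /= yL.
have -> : \sum_(t < L) Q (y t) (s (y t)) = \sum_(t < L) Q (y t) (y t.+1).
  by apply: eq_bigr => t _; rewrite !yE //=; have := ltn_ord t; lia.
rewrite (yE 0%N) //= !mulr2n; lra.
Qed.

(** Agreeing off [D], both permutations map [D] onto the same set, and an increasing bijection
    between finite chains is unique. *)
Lemma eq_perm_homo_in (N : nat) (s t : 'S_N) (D : pred 'I_N) :
  (forall i, ~~ D i -> s i = t i) ->
  {in D &, forall i j : 'I_N, (i < j)%N -> (s i < s j)%N} ->
  {in D &, forall i j : 'I_N, (i < j)%N -> (t i < t j)%N} ->
  s = t.
Proof.
move=> eqst smono tmono.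
(* At a first disagreement [i], the smaller of the two values would have to be
   taken later by the other, increasing, permutation. *)
have step (u v : 'S_N) (i : 'I_N) : (forall i, ~~ D i -> u i = v i) ->
    {in D &, forall i j : 'I_N, (i < j)%N -> (v i < v j)%N} ->
    (forall k : 'I_N, (k < i)%N -> u k = v k) -> ~ (u i < v i)%N.
  move=> equv vmono IH lt_uv.
  have Di : D i by apply: contraLR lt_uv => /equv ->; rewrite ltnn.
  pose k := (v^-1)%g (u i); have vk : v k = u i by rewrite /k permKV.
  have nki : u k <> v k.
    by rewrite vk => /perm_inj eki; rewrite -vk eki ltnn in lt_uv.
  have Dk : D k by apply: contra_notT nki => /equv.
  case: (ltngtP k i) => [/IH //|lt_ik|/val_inj eki].
    by have := vmono i k Di Dk lt_ik; rewrite vk ltnNge ltnW.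
  by move: lt_uv; rewrite -vk eki ltnn.
suff H n (i : 'I_N) : (i < n)%N -> s i = t i.
  by apply/permP => i; exact: (H i.+1).
elim: n i => // n IH i; rewrite ltnS => le_in.
have IHi (k : 'I_N) : (k < i)%N -> s k = t k.
  by move=> lt_ki; apply: IH; exact: leq_trans lt_ki le_in.
apply/val_inj; case: (ltngtP (s i) (t i)) => // lt_st; exfalso.
  exact: (step s t i eqst tmono IHi).
apply: (step t s i) lt_st => // k; last by move/IHi.
by move/eqst.
Qed.

Section Maximizer.

Variables (R : realType) (N : nat) (P : 'M[R]_N) (pi : 'S_N).
Hypotheses (hP : mixed_monge P) (hmax : maximizes_objective P pi).

Lemma max_swap (i k : 'I_N) : i != k ->
  P i (pi k) + P k (pi i) <= P i (pi i) + P k (pi k).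
Proof.
move=> nik; have := hmax (tperm i k * pi)%g; rewrite !perm_objectiveE.
have nki : k != i by rewrite eq_sym.
rewrite (bigD1 i) //= [X in _ <= X](bigD1 i) //=.
rewrite (bigD1 k) //= [X in _ <= _ + X](bigD1 k) //=.
rewrite !permM tpermL tpermR.
rewrite (eq_bigr (fun l => P l (pi l))); first lra.
by move=> l /andP[li lk]; rewrite permM tpermD // eq_sym.
Qed.

(** At an inversion between two such rows, (b) would make swapping their values a strict gain. *)
Lemma max_homo_deficiency :
  {in [pred i | (pi i <= i)%N] &,
     forall i k : 'I_N, (i < k)%N -> (pi i < pi k)%N}.
Proof.
move=> i k; rewrite !inE => di dk lt_ik.
case: (ltngtP (pi i) (pi k)) => // [lt_ki|/val_inj /perm_inj eik]; last first.
  by rewrite eik ltnn in lt_ik.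
have [_ b _] := hP lt_ik lt_ki.
have := max_swap (negbT (ltn_eqF lt_ik)).
rewrite leNgt b //; last by move=> [eik _]; move: lt_ki di; rewrite eik; lia.
- exact: leq_trans (ltnW lt_ki) di.
- exact: leq_trans di (ltnW lt_ik).
Qed.

Hypothesis hsym : antidiag_symmetric P.

Lemma max_loops (i : 'I_N) :
  P i (rev_ord i) + P (rev_ord (pi i)) (pi i) <= P i (pi i) *+ 2.
Proof.
pose Q i k := P i (rev_ord k); pose psi := (pi * perm (@rev_ord_inj N))%g.
have psiE k : psi k = rev_ord (pi k) by rewrite permM permE.
have QC k l : Q k l = Q l k by rewrite /Q hsym rev_ordK.
have psimax (p : 'S_N) : \sum_k Q k (p k) <= \sum_k Q k (psi k).
  have := hmax (p * perm (@rev_ord_inj N))%g; rewrite !perm_objectiveE.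
  under eq_bigr => k _ do rewrite permM permE.
  by under [X in _ -> _ <= X]eq_bigr => k _ do rewrite psiE /Q rev_ordK.
by have := symmetric_max_loops QC psimax i; rewrite psiE /Q rev_ordK.
Qed.

(** Off the anti-diagonal, [(i, j)] and its reflection are opposite corners of a rectangle whose
    other corners are the anti-diagonal entries in [max_loops]. As [i < j], (a) applies to it in
    either order of its rows and contradicts that bound. *)
Lemma max_excedance (i : 'I_N) : (i < pi i)%N -> pi i = rev_ord i.
Proof.
move=> lt_i; set j := pi i; have := max_loops i; rewrite mulr2n -/j.
rewrite {2}(hsym i j) => loops; apply/val_inj.
have iN := ltn_ord i; have jN := ltn_ord j; rewrite -/j in lt_i.
case: (ltngtP j (rev_ord i)) => // lt_j; exfalso; have /= lt_j' := lt_j.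
  have lt_ij : (i < rev_ord j)%N by rewrite /=; lia.
  have [a _ _] := hP lt_ij lt_j; move: loops; apply/negP; rewrite -ltNge.
  by apply: a => /=; [lia|lia|case=> /(congr1 val) /=; lia].
have lt_ij : (rev_ord j < i)%N by rewrite /=; lia.
have [a _ _] := hP lt_ij lt_j; move: loops; apply/negP; rewrite -ltNge.
rewrite [X in X < _]addrC [X in _ < X]addrC.
by apply: a => /=; [lia|lia|case=> _ /(congr1 val) /=; lia].
Qed.

End Maximizer.

Theorem lemma2p1 (R : realType) (N : nat) (P : 'M[R]_N) (pi : 'S_N)
    (hP : mixed_monge P) (hsym : antidiag_symmetric P)
    (hmax : maximizes_objective P pi) :
  antidiag_symmetric (perm_mx pi : 'M[R]_N).
Proof.
(* The matrix of [sigma] is the anti-diagonal reflection of that of [pi]. *)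
pose r := perm (@rev_ord_inj N); pose sigma : 'S_N := (r * pi^-1 * r)%g.
have rE i : r i = rev_ord i by rewrite permE.
have sigmaP i : pi (rev_ord (sigma i)) = rev_ord i.
  by rewrite !permM !rE rev_ordK permKV.
have lt_rev (i j : 'I_N) : (rev_ord i < rev_ord j)%N = (j < i)%N.
  by have := ltn_ord i; have := ltn_ord j; rewrite /=; lia.
have le_rev (i j : 'I_N) : (rev_ord i <= rev_ord j)%N = (j <= i)%N.
  by rewrite leqNgt lt_rev -leqNgt.
have exc := max_excedance hP hmax hsym.
have eq_exc (i : 'I_N) : (i < pi i)%N -> pi i = sigma i.
  move=> /exc pii; apply: (can_inj (@rev_ordK N)); apply: (@perm_inj _ pi).
  by rewrite sigmaP pii rev_ordK pii.
(* A strict excedance of [sigma] reflects to one of [pi], which lies on the anti-diagonal and so is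
   its own reflection. *)
have sigma_def (i : 'I_N) : (pi i <= i)%N -> (sigma i <= i)%N.
  apply: contraLR; rewrite -!ltnNge => lt_i.
  have := exc (rev_ord (sigma i)); rewrite sigmaP lt_rev rev_ordK => /(_ lt_i) e.
  by have := sigmaP i; rewrite -e rev_ordK => ->; rewrite e.
have homo := max_homo_deficiency hP hmax.
suff pisigma : pi = sigma.
  move=> i j; rewrite !mxE; congr ((_ : bool)%:R).
  rewrite -(inj_eq (@rev_ord_inj N) (pi i)) {1}pisigma.
  by rewrite -(inj_eq (@perm_inj _ pi)) sigmaP eq_sym.
apply: (eq_perm_homo_in (D := [pred i : 'I_N | (pi i <= i)%N])).
- by move=> i; rewrite /= -ltnNge => /eq_exc.
- exact: homo.
(* Reflection carries these rows to rows where [homo] applies to [pi]. *)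
move=> i k; rewrite !inE => /sigma_def di /sigma_def dk.
apply: contraTT; rewrite -!leqNgt leq_eqVlt => /orP[/eqP/val_inj/perm_inj->//|lt_s].
apply: ltnW; rewrite -lt_rev -(sigmaP i) -(sigmaP k).
by apply: homo; rewrite ?inE ?sigmaP ?le_rev ?lt_rev.
Qed.
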